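(* For every normed space $X$ there exists a $9$-Lipschitz retraction $r\colon X(3)\to X(2)$ (that is, a map with $d_H(r(A),r(B))\le 9\,d_H(A,B)$ for all $A,B\in X(3)$ and $r(A)=A$ for all $A\in X(2)$) such that for every $A\in X(3)$ the set $r(A)$ is contained in the convex hull of $A$.
   Context: For a metric space $X$ and $n\in\{1,2,\dots\}$, $X(n)$ denotes the set of all nonempty subsets of $X$ with at most $n$ elements, equipped with the Hausdorff metric $d_H$; thus $X(2)\subset X(3)$ isometrically. A normed space carries the metric $d(x,y)=\|x-y\|$. *)

(* Defs.v *)
From mathcomp Require Import all_boot all_order all_algebra.
From mathcomp Require Import all_classical all_reals all_analysis.

Set Implicit Arguments.
Unset Strict Implicit.
Unset Printing Implicit Defensive.

Import Order.TTheory GRing.Theory Num.Theory.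
Import numFieldNormedType.Exports.

Local Open Scope classical_set_scope.
Local Open Scope card_scope.
Local Open Scope ring_scope.

Definition finite_subsets (T : Type) (n : nat) : set (set T) :=
  [set A | A !=set0 /\ A #<= `I_n].
Arguments finite_subsets T n : clear implicits.

(* [sup] and [inf] are the real-valued ones, with default value 0; for nonempty
   finite sets every supremum and infimum below is attained, so the default is
   not used. *)
Definition hausdorff_dist (R : realType) (T : Type) (d : T -> T -> R)
    (A B : set T) : R :=
  Num.max (sup [set inf [set d a b | b in B] | a in A])
          (sup [set inf [set d a b | a in A] | b in B]).

Definition norm_dist (R : realType) (X : normedModType R) (x y : X) : R :=
  `|x - y|.
Arguments norm_dist {R} X.

Definition convex_hull (R : realType) (X : lmodType R) (A : set X) : set X :=
  smallest (@convex_set R X) A.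

(* Main.v *)
Require Import Defs.
From mathcomp Require Import all_boot all_order all_algebra.
From mathcomp Require Import all_classical all_reals all_analysis.
From mathcomp Require Import ring lra.

(** List a three-point set as a triple (a, b, c) whose closest pair is a, b; let
    p be the midpoint of a and b, and let l in [0, 1] be the ratio of |a - b| to
    the distance d from c to {a, b}. The retraction sends the triple to the pair
    p + (l/3)(c - p), c + (2l/3)(p - c). When l = 0, so that a = b, this pair is
    {a, c}; when l = 1, so that a second pair is as close as a, b, both of its
    points are the centroid p + (c - p)/3, and the choice of the closest pair
    makes no difference there.

    Let A and B be two such sets, each within e of the other. If some assignment
    of nearby points is a bijection, there are two cases.
    - It matches c with c' (retract_close_aligned). Then l (c - p) moves by at
      most 8e, since |c - p| <= (3/2) d compensates the division by d in l. The
      two points of the pair move by at most e + 8e/3 and e + 16e/3.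
    - It does not (retract_close_crossed). Then both triples are nearly tied,
      d - |a - b| <= 4e, so each pair lies within 4e of its own centroid. The
      centroids are e apart, which gives 4e + e + 4e = 9e: this case is where the
      constant 9 comes from.
    If there is no such bijection, two points of A share a near point in B and
    conversely, so both closest pairs are at distance at most 2e. A triple moves
    by at most |a - b| under the retraction (near_far_close), which gives
    2e + e + 2e = 5e.

    The estimate (retract_close) holds for any two admissible listings, so the
    retraction may use an arbitrarily chosen listing of each set. *)

Import Order.TTheory GRing.Theory Num.Theory.
Import numFieldNormedType.Exports.

Local Open Scope classical_set_scope.
Local Open Scope card_scope.
Local Open Scope ring_scope.

(** * Closeness of sets and the Hausdorff distance *)

Section Closeness.
Context {R : realType} {X : normedModType R}.
Implicit Types (A B C : set X) (K L : R).

(** Closeness for a given K is the form in which the estimates are proved: unlike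
    the Hausdorff distance it involves no supremum, and it composes by the
    triangle inequality. *)
Definition within K A B := forall x, A x -> exists2 y, B y & `|x - y| <= K.

Definition close K A B := within K A B /\ within K B A.

Lemma within_trans {K L A B C} :
  within K A B -> within L B C -> within (K + L) A C.
Proof.
move=> AB BC x /AB[y /BC[z Cz yz] xy]; exists z => //.
by rewrite (le_trans (ler_distD y x z)) ?lerD.
Qed.

Lemma close_trans {K L A B C} : close K A B -> close L B C -> close (K + L) A C.
Proof.
move=> [AB BA] [BC CB]; split; first exact: within_trans AB BC.
by rewrite addrC; exact: within_trans CB BA.
Qed.

Lemma closeC {K A B} : close K A B -> close K B A.
Proof. by case. Qed.

Lemma close_le {K L A B} : K <= L -> close K A B -> close L A B.
Proof.
by move=> KL [AB BA]; split=> x => [/AB|/BA] [y ? xy]; exists y => //;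
  exact: le_trans xy KL.
Qed.

Lemma close_pair {K} {x y x' y' : X} :
  `|x - x'| <= K -> `|y - y'| <= K -> close K [set x; y] [set x'; y'].
Proof.
move=> xx' yy'; split=> z [] ->.
- by exists x' => //; left.
- by exists y' => //; right.
- by exists x; [left|rewrite distrC].
- by exists y; [right|rewrite distrC].
Qed.

Lemma set3_nonempty (a b c : X) : [set a; b; c] !=set0.
Proof. by exists a; left; left. Qed.

Let dist_to_bounded_below (x : X) B :
  has_lbound [set norm_dist X x b | b in B].
Proof. by exists 0 => _ [b _ <-]; exact: normr_ge0. Qed.

Lemma sup_inf_dist_le {K A B} : A !=set0 -> within K A B ->
  sup [set inf [set norm_dist X a b | b in B] | a in A] <= K.
Proof.
move=> [a0 Aa0] AB; apply: ge_sup; first by eexists; exists a0.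
move=> _ [a Aa <-]; have [b Bb ab] := AB a Aa.
apply: le_trans ab; apply: ge_inf; first exact: dist_to_bounded_below.
by exists b.
Qed.

(** The upper bound is required because the supremum of an unbounded set is 0 by
    convention. *)
Lemma within_sup_inf_dist {K A B} :
    has_ubound [set inf [set norm_dist X a b | b in B] | a in A] ->
    B !=set0 ->
    sup [set inf [set norm_dist X a b | b in B] | a in A] < K ->
  within K A B.
Proof.
move=> ubA [b0 Bb0] supK a Aa.
set D := [set norm_dist X a b | b in B].
have infK : inf D < K.
  by apply: le_lt_trans supK; apply: ub_le_sup => //; exists a.
have hD : has_inf D.
  by split; [exists (norm_dist X a b0), b0|exact: dist_to_bounded_below].
have gap : 0 < K - inf D by rewrite subr_gt0.
have [_ [b Bb <-]] := inf_adherent gap hD.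
by rewrite addrC subrK => abK; exists b => //; exact: ltW.
Qed.

Lemma set3_inf_dist_bounded (a b c : X) B :
  has_ubound [set inf [set norm_dist X x y | y in B] | x in [set a; b; c]].
Proof.
pose f x := inf [set norm_dist X x y | y in B].
exists (Num.max (f a) (Num.max (f b) (f c))).
by move=> _ [x [[]|] -> <-]; rewrite !le_max lexx ?orbT.
Qed.

Lemma norm_dist_swap A (x : X) :
  [set norm_dist X y x | y in A] = [set norm_dist X x y | y in A].
Proof. by apply: eq_imagel => y _; rewrite /norm_dist distrC. Qed.

Lemma hausdorff_distE A B :
  hausdorff_dist (norm_dist X) A B =
  Num.max (sup [set inf [set norm_dist X a b | b in B] | a in A])
          (sup [set inf [set norm_dist X b a | a in A] | b in B]).
Proof.
rewrite /hausdorff_dist; congr (Num.max _ (sup _)).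
by apply: eq_imagel => b _; rewrite norm_dist_swap.
Qed.

Lemma hausdorff_dist_le {K A B} : A !=set0 -> B !=set0 -> close K A B ->
  hausdorff_dist (norm_dist X) A B <= K.
Proof.
by move=> A0 B0 [AB BA]; rewrite hausdorff_distE ge_max !sup_inf_dist_le.
Qed.

(** The strict inequality leaves room for choosing points that only come close to
    the infima in the Hausdorff distance. *)
Lemma close_hausdorff {K} {a b c a' b' c' : X} :
  hausdorff_dist (norm_dist X) [set a; b; c] [set a'; b'; c'] < K ->
  close K [set a; b; c] [set a'; b'; c'].
Proof.
rewrite hausdorff_distE gt_max => /andP[AB BA].
by split; apply: within_sup_inf_dist => //;
  [exact: set3_inf_dist_bounded|exact: set3_nonempty
  |exact: set3_inf_dist_bounded|exact: set3_nonempty].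
Qed.

End Closeness.

(** * The retraction on ordered triples *)

Section Retraction.
Context {R : realType} {X : normedModType R}.
Implicit Types a b c : X.

Definition closest_first a b c := `|a - b| <= `|a - c| /\ `|a - b| <= `|b - c|.

Definition mid a b := 2^-1 *: (a + b).

Definition dist_third a b c := Num.min `|a - c| `|b - c|.

(** When the three points coincide this is 0 / 0 = 0, so ratio_dist_third below holds
    for degenerate triples as well. *)
Definition ratio a b c := `|a - b| / dist_third a b c.

(** The pair is normalised so that it collapses to the centroid when the
    ratio is 1: the weights 1/3 and 2/3 are those of the centroid on the segment
    from the midpoint to the third point. *)
Definition near_point a b c := mid a b + (ratio a b c / 3) *: (c - mid a b).

Definition far_point a b c := c + (2 * ratio a b c / 3) *: (mid a b - c).

Definition retract a b c := [set near_point a b c; far_point a b c].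

Lemma closest_firstC {a b c} : closest_first a b c -> closest_first b a c.
Proof. by rewrite /closest_first [`|b - a|]distrC => -[]. Qed.

Lemma retractC a b c : retract b a c = retract a b c.
Proof.
rewrite /retract /near_point /far_point /ratio /dist_third /mid.
by rewrite [b + a]addrC [`|b - a|]distrC minC.
Qed.

Lemma ratio_ge0 a b c : 0 <= ratio a b c.
Proof. by rewrite divr_ge0 // le_min !normr_ge0. Qed.

Lemma le_dist_third {a b c} :
  closest_first a b c -> `|a - b| <= dist_third a b c.
Proof. by move=> [ac bc]; rewrite le_min ac bc. Qed.

Lemma ratio_dist_third {a b c} : closest_first a b c ->
  ratio a b c * dist_third a b c = `|a - b|.
Proof.
move=> /le_dist_third abc; rewrite /ratio.
have [d0|d0] := eqVneq (dist_third a b c) 0; last by rewrite divfK.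
by apply/eqP; rewrite d0 mulr0 eq_le normr_ge0 -d0 abc.
Qed.

Lemma ratio_le1 {a b c} : closest_first a b c -> ratio a b c <= 1.
Proof.
move=> abc; have := le_dist_third abc; rewrite -(ratio_dist_third abc).
have d0 : 0 <= dist_third a b c by rewrite le_min !normr_ge0.
have [d1|d1] := eqVneq (dist_third a b c) 0.
  by rewrite /ratio d1 invr0 mulr0.
by rewrite ger_pMl // lt_def d1.
Qed.

Lemma mid_distl a b : `|a - mid a b| = `|a - b| / 2.
Proof.
rewrite /mid -[in RHS](ger0_norm (_ : 0 <= 2^-1 :> R)) ?invr_ge0 //.
rewrite mulrC -normrZ scalerBr; congr `|_|.
by rewrite scalerDr opprD addrA -{1}[a]scale1r -scalerBl; congr (_ *: _ - _); field.
Qed.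

Lemma midC a b : mid a b = mid b a.
Proof. by rewrite /mid addrC. Qed.

Lemma mid_distr a b : `|b - mid a b| = `|a - b| / 2.
Proof. by rewrite midC mid_distl distrC. Qed.

(** Half of |a - b| is added to the distance from c to the nearer of a and b; it
    is at most half of that distance because a, b is the closest pair. *)
Lemma norm_third_mid {a b c} : closest_first a b c ->
  `|c - mid a b| <= 3 / 2 * dist_third a b c.
Proof.
move=> abc; have := le_dist_third abc.
have := ler_distD a c (mid a b); have := ler_distD b c (mid a b).
rewrite mid_distl mid_distr [`|c - a|]distrC [`|c - b|]distrC /dist_third.
by case: (leP `|a - c| `|b - c|); lra.
Qed.

(** * Perturbation estimates *)

(** The displacement along c - mid a b is at most (2/3) * (3/2) * |a - b|, because
    the ratio cancels the distance of the third point. *)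
Lemma near_far_close {a b c} : closest_first a b c ->
  close `|a - b| (retract a b c) [set a; b; c].
Proof.
move=> abc.
have l0 := ratio_ge0 a b c; have l1 := ratio_dist_third abc.
have u0 := norm_third_mid abc.
have shift : ratio a b c * `|c - mid a b| <= 3 / 2 * `|a - b|.
  by rewrite -l1; have := ler_wpM2l l0 u0; lra.
have near x : `|x - mid a b| = `|a - b| / 2 ->
    `|near_point a b c - x| <= `|a - b|.
  move=> xm; rewrite distrC /near_point opprD addrA.
  apply: le_trans (ler_normB _ _) _; rewrite xm normrZ ger0_norm; lra.
have na := near a (mid_distl a b).
have nb := near b (mid_distr a b).
have fc : `|far_point a b c - c| <= `|a - b|.
  rewrite /far_point addrAC subrr add0r normrZ distrC.
  by rewrite ger0_norm; lra.
split.
- by move=> x [] ->; [exists a => //; left; left|exists c => //; right].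
- by move=> x [[]|] ->; [exists (near_point a b c); [left|rewrite distrC]..|
    exists (far_point a b c); [right|rewrite distrC]].
Qed.

Lemma dist_perturb {e : R} {x y x' y' : X} : `|x - x'| <= e -> `|y - y'| <= e ->
  `|x - y| <= `|x' - y'| + 2 * e.
Proof.
move=> xx yy; have := ler_distD x' x y; have := ler_distD y' x' y.
by rewrite [`|y' - y|]distrC; lra.
Qed.

Lemma dist_perturb_abs {e : R} {x y x' y' : X} :
  `|x - x'| <= e -> `|y - y'| <= e -> `| `|x - y| - `|x' - y'| | <= 2 * e.
Proof.
move=> xx yy; have := dist_perturb xx yy.
rewrite distrC in xx; rewrite distrC in yy; have := dist_perturb xx yy.
by rewrite ler_norml; lra.
Qed.

Lemma mid_perturb {e : R} {a b a' b'} : `|a - a'| <= e -> `|b - b'| <= e ->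
  `|mid a b - mid a' b'| <= e.
Proof.
move=> aa bb; rewrite -scalerBr opprD addrACA normrZ ger0_norm ?invr_ge0 //.
by have := ler_normD (a - a') (b - b'); lra.
Qed.

(** The change of the ratio is multiplied by the distance of the third point before
    it is estimated, so that no division occurs and degenerate triples need no
    separate treatment. Writing u = c - mid a b and l for the ratio, the change
    l (u - u') contributes 2e and (l - l') u' contributes (3/2) * 4e. *)
Lemma shift_perturb {e : R} {a b c a' b' c'} :
    closest_first a b c -> closest_first a' b' c' ->
    `|a - a'| <= e -> `|b - b'| <= e -> `|c - c'| <= e ->
  `|ratio a b c *: (c - mid a b) - ratio a' b' c' *: (c' - mid a' b')|
    <= 8 * e.
Proof.
move=> S S' aa bb cc.
have l0 := ratio_ge0 a b c; have l1 := ratio_le1 S.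
have lE := ratio_dist_third S; have lE' := ratio_dist_third S'.
have u' := norm_third_mid S'.
have d0' : 0 <= dist_third a' b' c' by rewrite le_min !normr_ge0.
have dab := dist_perturb_abs aa bb.
have dd : `|dist_third a' b' c' - dist_third a b c| <= 2 * e.
  have := dist_perturb_abs aa cc; have := dist_perturb_abs bb cc.
  rewrite /dist_third !ler_norml.
  by case: (leP `|a - c| _); case: (leP `|a' - c'| _); lra.
have du : `|(c - mid a b) - (c' - mid a' b')| <= 2 * e.
  have -> : c - mid a b - (c' - mid a' b') = (c - c') - (mid a b - mid a' b').
    by rewrite !opprB [mid a' b' - c']addrC addrACA [- mid a b + _]addrC.
  have := ler_normB (c - c') (mid a b - mid a' b').
  by have := mid_perturb aa bb; lra.
set l := ratio a b c in l0 l1 lE *; set l' := ratio a' b' c' in lE' *.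
set u := c - mid a b in du *; set v := c' - mid a' b' in u' du *.
clearbody u v l l'.
have -> : l *: u - l' *: v = l *: (u - v) + (l - l') *: v.
  by rewrite scalerBr scalerBl addrA subrK.
have dl : `|l - l'| * dist_third a' b' c' <= 4 * e.
  rewrite -[X in _ * X](ger0_norm d0') -normrM.
  have -> : (l - l') * dist_third a' b' c' =
      l * (dist_third a' b' c' - dist_third a b c) + (`|a - b| - `|a' - b'|).
    by rewrite -lE -lE'; ring.
  apply: le_trans (ler_normD _ _) _; rewrite normrM (ger0_norm l0).
  have := ler_piMl (normr_ge0 (dist_third a' b' c' - dist_third a b c)) l1.
  by lra.
apply: le_trans (ler_normD _ _) _; rewrite !normrZ (ger0_norm l0).
have := ler_piMl (normr_ge0 (u - v)) l1.
by have := ler_wpM2l (normr_ge0 (l - l')) u'; lra.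
Qed.

Lemma addZ_perturb {k x y : R} {p p' s s' : X} : 0 <= k ->
  `|p - p'| <= x -> `|s - s'| <= y -> `|p + k *: s - (p' + k *: s')| <= x + k * y.
Proof.
move=> k0 pp ss; rewrite opprD addrACA -scalerBr.
apply: le_trans (ler_normD _ _) _; rewrite normrZ (ger0_norm k0).
by rewrite lerD // ler_wpM2l.
Qed.

Lemma retract_close_aligned {e : R} {a b c a' b' c'} :
    closest_first a b c -> closest_first a' b' c' ->
    `|a - a'| <= e -> `|b - b'| <= e -> `|c - c'| <= e ->
  close (9 * e) (retract a b c) (retract a' b' c').
Proof.
move=> S S' aa bb cc.
have ds := shift_perturb S S' aa bb cc.
have dm := mid_perturb aa bb.
have e0 : 0 <= e := le_trans (normr_ge0 _) aa.
have nearE x y z :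
    near_point x y z = mid x y + 3^-1 *: (ratio x y z *: (z - mid x y)).
  by rewrite /near_point scalerA [ratio x y z / 3]mulrC.
have farE x y z :
    far_point x y z = z + (2 / 3) *: - (ratio x y z *: (z - mid x y)).
  by rewrite /far_point -scalerN opprB scalerA mulrAC.
have ds' : `|- (ratio a b c *: (c - mid a b)) -
    - (ratio a' b' c' *: (c' - mid a' b'))| <= 8 * e.
  by rewrite -opprD normrN.
apply: close_pair.
- rewrite !nearE; apply: le_trans (addZ_perturb _ dm ds) _; lra.
- rewrite !farE; apply: le_trans (addZ_perturb _ cc ds') _; lra.
Qed.

Definition centroid a b c := 3^-1 *: (a + b + c).

Lemma centroidE a b c : centroid a b c = mid a b + 3^-1 *: (c - mid a b).
Proof.
have E : a + b = 2 *: mid a b by rewrite scalerA mulfV ?scale1r ?pnatr_eq0.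
rewrite /centroid E; move: (mid a b) => p.
rewrite scalerDr scalerBr scalerA addrCA [RHS]addrC; congr (_ + _).
by rewrite -{2}[p]scale1r -scalerBl; congr (_ *: _); field.
Qed.

Lemma near_point_centroid a b c :
  near_point a b c - centroid a b c =
  - ((1 - ratio a b c) / 3) *: (c - mid a b).
Proof.
rewrite centroidE /near_point opprD addrACA subrr add0r -scalerBl.
by congr (_ *: _); field.
Qed.

Lemma far_point_centroid a b c :
  far_point a b c - centroid a b c =
  (2 * (1 - ratio a b c) / 3) *: (c - mid a b).
Proof.
rewrite centroidE /far_point -[mid a b - c]opprB scalerN opprD addrACA -opprB.
rewrite opprB -{1}[c - _]scale1r -opprD -scalerDl -scalerBl.
by congr (_ *: _); field.
Qed.

(** Both differences are multiples of (1 - l)(c - mid a b), whose norm is at most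
    3/2 times the gap between the two smallest distances in the triple. *)
Lemma retract_close_centroid {K : R} {a b c} : closest_first a b c ->
    dist_third a b c <= `|a - b| + K ->
  `|near_point a b c - centroid a b c| <= K / 2 /\
  `|far_point a b c - centroid a b c| <= K.
Proof.
move=> S dK; rewrite near_point_centroid far_point_centroid.
have l1 := ratio_le1 S; have lE := ratio_dist_third S.
have l1' : 0 <= 1 - ratio a b c by rewrite subr_ge0.
have := ler_wpM2l l1' (norm_third_mid S).
move: (ratio a b c) (c - mid a b) l1 lE l1' => l u l1 lE l1'.
by rewrite scaleNr normrN !normrZ !ger0_norm; do ?lra; split; lra.
Qed.

Lemma centroid_perturb {e : R} {a b c a' b' c'} :
    `|a - a'| <= e -> `|b - b'| <= e -> `|c - c'| <= e ->
  `|centroid a b c - centroid a' b' c'| <= e.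
Proof.
move=> aa bb cc; rewrite -scalerBr.
have -> : a + b + c - (a' + b' + c') = a - a' + (b - b') + (c - c').
  by rewrite !opprD addrACA [a + b + _]addrACA.
rewrite normrZ ger0_norm ?invr_ge0 //.
have := ler_normD (a - a' + (b - b')) (c - c').
by have := ler_normD (a - a') (b - b'); lra.
Qed.

(** The far points c and c' are not matched, so the closest pair of each triple is
    matched with a pair that contains the far point of the other. Hence the two
    smallest distances of each triple differ by at most 4e. *)
Lemma retract_close_crossed {e : R} {a b c a' b' c'} :
    closest_first a b c -> closest_first a' b' c' ->
    `|a - c'| <= e -> `|b - b'| <= e -> `|c - a'| <= e ->
  close (9 * e) (retract a b c) (retract a' b' c').
Proof.
move=> S S' ac bb ca.
have e0 : 0 <= e := le_trans (normr_ge0 _) ac.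
have [Sl Sr] := S; have [Sl' Sr'] := S'.
have bc : `|b - c| <= `|a' - b'| + 2 * e.
  by rewrite [`|a' - b'|]distrC; exact: dist_perturb.
have bc' : `|b' - c'| <= `|a - b| + 2 * e.
  by rewrite [`|a - b|]distrC; apply: dist_perturb; rewrite distrC.
have gap : dist_third a b c <= `|a - b| + 4 * e.
  by rewrite /dist_third ge_min; apply/orP; right; lra.
have gap' : dist_third a' b' c' <= `|a' - b'| + 4 * e.
  by rewrite /dist_third ge_min; apply/orP; right; lra.
have [near far] := retract_close_centroid S gap.
have [near' far'] := retract_close_centroid S' gap'.
have mm : `|centroid a b c - centroid a' b' c'| <= e.
  have -> : centroid a' b' c' = centroid c' b' a'.
    by rewrite /centroid [a' + b' + c']addrC [a' + b']addrC addrA.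
  exact: centroid_perturb.
have via x x' : `|x - centroid a b c| <= 4 * e ->
    `|x' - centroid a' b' c'| <= 4 * e -> `|x - x'| <= 9 * e.
  move=> xm xm'; have := ler_distD (centroid a b c) x x'.
  have := ler_distD (centroid a' b' c') (centroid a b c) x'.
  by rewrite [`|centroid a' b' c' - _|]distrC; lra.
by apply: close_pair; apply: via; lra.
Qed.

(** * Matching two triples *)

(** Pigeonhole: two points with a common near point are 2e-close, and the closest
    pair is then 2e-close too; otherwise the assignment is one of six bijections,
    listed here by the image of c. *)
Lemma within_matching {e : R} {a b c a' b' c'} : closest_first a b c ->
    within e [set a; b; c] [set a'; b'; c'] ->
  `|a - b| <= 2 * e \/
  ((`|c - c'| <= e /\ (`|a - a'| <= e /\ `|b - b'| <= e \/
                       `|a - b'| <= e /\ `|b - a'| <= e)) \/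
   (`|c - a'| <= e /\ (`|a - c'| <= e /\ `|b - b'| <= e \/
                       `|a - b'| <= e /\ `|b - c'| <= e)) \/
   (`|c - b'| <= e /\ (`|a - c'| <= e /\ `|b - a'| <= e \/
                       `|a - a'| <= e /\ `|b - c'| <= e))).
Proof.
move=> [ac bc] AB.
have shared (x y z : X) : `|x - z| <= e -> `|y - z| <= e -> `|x - y| <= 2 * e.
  by move=> xz yz; have := ler_distD z x y; rewrite [`|z - y|]distrC; lra.
have [|x Bx ax] := AB a; first by left; left.
have [|y By bx] := AB b; first by left; right.
have [|z Bz cx] := AB c; first by right.
have [xy|xy] := pselect (x = y).
  by left; apply: (shared _ _ x); rewrite // xy.
have [xz|xz] := pselect (x = z).
  by left; apply: le_trans ac _; apply: (shared _ _ x); rewrite // xz.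
have [yz|yz] := pselect (y = z).
  by left; apply: le_trans bc _; apply: (shared _ _ y); rewrite // yz.
right; move: ax bx cx xy xz yz.
by case: Bx => [[]|] ->; case: By => [[]|] ->; case: Bz => [[]|] ->; tauto.
Qed.

Lemma retract_close_matched {e : R} {a b c a' b' c'} :
    closest_first a b c -> closest_first a' b' c' ->
    within e [set a; b; c] [set a'; b'; c'] ->
  `|a - b| <= 2 * e \/ close (9 * e) (retract a b c) (retract a' b' c').
Proof.
move=> S S' AB; have Sw := closest_firstC S; have Sw' := closest_firstC S'.
have [|[[cc [[]|[]]]|[[ca [[]|[]]]|[cb [[]|[]]]]] h1 h2] :=
  within_matching S AB; [by left|right..].
- exact: retract_close_aligned.
- by rewrite -[retract a' b' c']retractC; exact: retract_close_aligned.
- exact: retract_close_crossed.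
- by rewrite -[retract a b c]retractC; exact: retract_close_crossed.
- by rewrite -[retract a' b' c']retractC; exact: retract_close_crossed.
- rewrite -[retract a b c]retractC -[retract a' b' c']retractC.
  exact: retract_close_crossed.
Qed.

Lemma retract_close {e : R} {a b c a' b' c'} :
    closest_first a b c -> closest_first a' b' c' ->
    close e [set a; b; c] [set a'; b'; c'] ->
  close (9 * e) (retract a b c) (retract a' b' c').
Proof.
move=> S S' AB.
have e0 : 0 <= e.
  by have [|x _] := AB.1 a; [left; left|exact: le_trans].
have [ab|//] := retract_close_matched S S' AB.1.
have [ab'|/closeC//] := retract_close_matched S' S AB.2.
have rA := close_le ab (near_far_close S).
have rB := close_le ab' (near_far_close S').
by apply: close_le (close_trans (close_trans rA AB) (closeC rB)); lra.
Qed.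

(** * Convex hull *)

Lemma convex_hull_segment {A : set X} {x y : X} {t : R} : 0 <= t <= 1 ->
  convex_hull A x -> convex_hull A y -> convex_hull A (x + t *: (y - x)).
Proof.
move=> /andP[t0 t1] hx hy C [convC AC].
have Cx : x \in C by rewrite inE; exact: hx.
have Cy : y \in C by rewrite inE; exact: hy.
have := convC y x (Itv01 t0 t1) Cy Cx; rewrite inE; congr (C _).
by rewrite /conv /= /unstable.onem scalerBr scalerBl scale1r addrCA addrA.
Qed.

Lemma retract_sub_hull {a b c} : closest_first a b c ->
  retract a b c `<=` convex_hull [set a; b; c].
Proof.
move=> S; have l0 := ratio_ge0 a b c; have l1 := ratio_le1 S.
have hull x : [set a; b; c] x -> convex_hull [set a; b; c] x.
  exact: sub_smallest.
have hc : convex_hull [set a; b; c] c by apply: hull; right.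
have hm : convex_hull [set a; b; c] (mid a b).
  have -> : mid a b = a + 2^-1 *: (b - a).
    rewrite /mid scalerDr scalerBr addrCA [RHS]addrC; congr (_ + _).
    by rewrite -{2}[a]scale1r -scalerBl; congr (_ *: _); field.
  apply: convex_hull_segment; first by lra.
  - by apply: hull; left; left.
  - by apply: hull; left; right.
by move=> _ [] ->; apply: convex_hull_segment => //; lra.
Qed.

(** * Listing sets as triples *)

Lemma card_le_II_image {T : Type} {n : nat} {A : set T} :
  A !=set0 -> A #<= `I_n -> exists f : nat -> T, A = f @` `I_n.
Proof.
move=> A0 /pfcard_geP[AE|[f]]; first by move: A0; rewrite AE => -[].
by exists f; apply/esym/surj_image_eq; [exact: fun_image_sub|exact: surj].
Qed.

Lemma finite_subsets3_triple {A : set X} : finite_subsets X 3 A ->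
  exists a b c, closest_first a b c /\ A = [set a; b; c].
Proof.
move=> [A0 /(card_le_II_image A0)[f ->]].
have -> : f @` `I_3 = [set f 0%N; f 1%N; f 2%N].
  apply/seteqP; split=> x.
  - move=> [[|[|[|//]]] _ <-]; [by left; left|by left; right|by right].
  - by move=> [[]|] ->; [exists 0%N|exists 1%N|exists 2%N].
move: (f 0%N) (f 1%N) (f 2%N) => a b c.
have [ab_ac|/ltW ac_ab] := leP `|a - b| `|a - c|;
    have [ab_bc|/ltW bc_ab] := leP `|a - b| `|b - c|.
- by exists a, b, c.
- exists b, c, a; split; last by rewrite -setUA setUC.
  by rewrite /closest_first [`|b - a|]distrC [`|c - a|]distrC; split; lra.
- exists a, c, b; split; last by rewrite setUAC.
  by rewrite /closest_first [`|c - b|]distrC; split; lra.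
have [bc_ac|/ltW ac_bc] := leP `|b - c| `|a - c|.
- exists b, c, a; split; last by rewrite -setUA setUC.
  by rewrite /closest_first [`|b - a|]distrC [`|c - a|]distrC.
- exists a, c, b; split; last by rewrite setUAC.
  by rewrite /closest_first [`|c - b|]distrC.
Qed.

Lemma finite_subsets_pair (x y : X) : finite_subsets X 2 [set x; y].
Proof.
split; first by exists x; left.
have -> : [set x; y] = (fun n : nat => if n is 0%N then x else y) @` `I_2.
  apply/seteqP; split=> z.
  - by move=> [] ->; [exists 0%N|exists 1%N].
  - by move=> [[|n] _ <-]; [left|right].
exact: card_image_le.
Qed.

(** Two of the three listed points coincide, so the closest pair does: a = b and
    the ratio vanishes. *)
Lemma retract_fixes_pairs {a b c} : closest_first a b c ->
  finite_subsets X 2 [set a; b; c] -> retract a b c = [set a; b; c].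
Proof.
move=> S [A0 /(card_le_II_image A0)[f AE]].
have ab : a = b.
  have mem x : [set a; b; c] x -> x = f 0%N \/ x = f 1%N.
    by rewrite AE => -[[|[|//]] _ <-]; [left|right].
  have eq0 (x y : X) : `|a - b| <= `|x - y| -> x = y -> a = b.
    move=> abxy xy; apply/eqP; rewrite -subr_eq0 -normr_le0.
    by rewrite (le_trans abxy) // xy subrr normr0.
  have [ac bc] := S.
  have ma : [set a; b; c] a by left; left.
  have mb : [set a; b; c] b by left; right.
  have mc : [set a; b; c] c by right.
  have [Ea|Ea] := mem a ma; have [Eb|Eb] := mem b mb; first by rewrite Ea Eb.
  - have [Ec|Ec] := mem c mc; [apply: (eq0 a c)|apply: (eq0 b c)] => //;
      by rewrite ?Ea ?Eb Ec.
  - have [Ec|Ec] := mem c mc; [apply: (eq0 b c)|apply: (eq0 a c)] => //;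
      by rewrite ?Ea ?Eb Ec.
  - by rewrite Ea Eb.
have l0 : ratio b b c = 0 by rewrite /ratio subrr normr0 mul0r.
have m : mid b b = b.
  by rewrite /mid -mulr2n -[b *+ 2]scaler_nat scalerA mulVf ?scale1r // pnatr_eq0.
rewrite ab /retract /near_point /far_point l0 m.
by rewrite mulr0 mul0r !scale0r !addr0 setUid.
Qed.

End Retraction.

Theorem theorem5p2 (R : realType) (X : normedModType R) :
  exists r : set X -> set X,
    [/\ forall A : set X, finite_subsets X 3 A -> finite_subsets X 2 (r A),
        forall A B : set X, finite_subsets X 3 A -> finite_subsets X 3 B ->
          hausdorff_dist (norm_dist X) (r A) (r B)
            <= 9 * hausdorff_dist (norm_dist X) A B,
        forall A : set X, finite_subsets X 2 A -> r A = A
      & forall A : set X, finite_subsets X 3 A -> r A `<=` convex_hull A].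
Proof.
have rep (A : set X) : exists B, finite_subsets X 3 A -> exists a b c,
    [/\ closest_first a b c, A = [set a; b; c] & B = retract a b c].
  have [/finite_subsets3_triple[a [b [c [S AE]]]]|nA] :=
    pselect (finite_subsets X 3 A); last by exists set0.
  by exists (retract a b c) => _; exists a, b, c.
have [r rP] := choice rep.
have sub23 (A : set X) : finite_subsets X 2 A -> finite_subsets X 3 A.
  by move=> [A0 A2]; split => //; apply: card_le_trans A2 _; rewrite card_le_II.
exists r; split.
- by move=> A /rP[a [b [c [_ _ ->]]]]; exact: finite_subsets_pair.
- move=> A B /rP[a [b [c [S -> ->]]]] /rP[a' [b' [c' [S' -> ->]]]].
  apply/ler_addgt0Pr => e e0.
  (* the slack e / 9 makes the Hausdorff distance strictly smaller than the bound
     passed to close_hausdorff *)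
  set h := hausdorff_dist _ [set a; b; c] _.
  have hlt : h < h + e / 9 by rewrite ltrDl divr_gt0.
  have -> : 9 * h + e = 9 * (h + e / 9) by field.
  apply: hausdorff_dist_le; [exact: (finite_subsets_pair _ _).1..|].
  exact: retract_close S S' (close_hausdorff hlt).
- move=> A A2; have [a [b [c [S AE ->]]]] := rP A (sub23 A A2).
  by rewrite AE in A2 *; exact: retract_fixes_pairs.
- by move=> A /rP[a [b [c [S -> ->]]]]; exact: retract_sub_hull.
Qed.
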